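(* Let $(\mathcal{C},\otimes,1)$ be a monoidal category which has equalizers and in which every object is flat. Let $\psi:C\to D$ be a morphism of coalgebras in $\mathcal{C}$. Then the following assertions are equivalent: (i) $\psi$ is a split-epi as a $D$-bicomodule morphism in $\mathcal{C}$, i.e. there exists a $D$-bicomodule morphism $\chi:D\to C$ in $\mathcal{C}$ such that $\psi\circ\chi=\mathrm{Id}_D$; (ii) there is a $D$-bicomodule morphism $\chi:D\to C$ in $\mathcal{C}$ such that $\varepsilon_C\circ\chi=\varepsilon_D$. If one of these equivalent conditions holds, then (iii) the coinduction functor $\psi^*=-\square_D C:\mathcal{C}^D\to\mathcal{C}^C$ is separable. Moreover, if the unit object $1$ of $\mathcal{C}$ is a left $\otimes$-cogenerator, then (iii) is equivalent to (i) and (ii).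
   Context: Associativity and unit constraints are suppressed. For a coalgebra $C$ in $\mathcal{C}$, $\Delta_C$ and $\varepsilon_C:C\to1$ are its comultiplication and counit, and $\mathcal{C}^C$ (resp. ${}^C\mathcal{C}$) is the category of right (resp. left) $C$-comodules in $\mathcal{C}$. An object $X$ is flat if both $X\otimes-$ and $-\otimes X$ preserve equalizers. For a right $C$-comodule $(V,\rho)$ and a left $C$-comodule $(W,\lambda)$, $e^C_{V,W}:V\square_C W\to V\otimes W$ is the equalizer of $\rho\otimes\mathrm{Id}_W$ and $\mathrm{Id}_V\otimes\lambda$. Given a coalgebra morphism $\psi:C\to D$, $C$ is a $D$-bicomodule via $(\psi\otimes\mathrm{Id}_C)\Delta_C$ and $(\mathrm{Id}_C\otimes\psi)\Delta_C$. The coinduction functor $\psi^*=-\square_D C:\mathcal{C}^D\to\mathcal{C}^C$ sends $M$ to $M\square_D C$ with right $C$-coaction $\rho$ uniquely determined by $(e^D_{M,C}\otimes\mathrm{Id}_C)\rho=(\mathrm{Id}_M\otimes\Delta_C)e^D_{M,C}$, and sends $f:M\to N$ to the unique morphism $f\square_D C$ with $e^D_{N,C}(f\square_D C)=(f\otimes\mathrm{Id}_C)e^D_{M,C}$. An object $Q$ is a left $\otimes$-cogenerator of $\mathcal{C}$ if for any morphisms $f,g:Y\to Z\otimes W$ in $\mathcal{C}$ with $(\xi\otimes\mathrm{Id}_W)f=(\xi\otimes\mathrm{Id}_W)g$ for every $\xi:Z\to Q$ in $\mathcal{C}$, one has $f=g$. A functor $F:\mathcal{A}\to\mathcal{B}$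 induces the natural transformation $\mathcal{F}:\mathrm{Hom}_{\mathcal{A}}(-,-)\to\mathrm{Hom}_{\mathcal{B}}(F-,F-)$, $f\mapsto F(f)$. $F$ is separable if there is a natural transformation $\mathcal{P}:\mathrm{Hom}_{\mathcal{B}}(F-,F-)\to\mathrm{Hom}_{\mathcal{A}}(-,-)$ with $\mathcal{P}\circ\mathcal{F}=\mathrm{Id}$. *)

(* Defs.v *)
From Stdlib Require Import ssreflect.
From Stdlib Require Import Classical ClassicalEpsilon.

Set Implicit Arguments.
Unset Strict Implicit.
Unset Printing Implicit Defensive.

Declare Scope cat_scope.
Delimit Scope cat_scope with cat.
Open Scope cat_scope.

Record Category := {
  Ob :> Type;
  Hom : Ob -> Ob -> Type;
  idm : forall A, Hom A A;
  comp : forall A B C, Hom B C -> Hom A B -> Hom A C;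
  comp_assoc : forall A B C D (h : Hom C D) (g : Hom B C) (f : Hom A B),
    comp h (comp g f) = comp (comp h g) f;
  comp_id_l : forall A B (f : Hom A B), comp (idm B) f = f;
  comp_id_r : forall A B (f : Hom A B), comp f (idm A) = f
}.

Arguments Hom {_} _ _.
Arguments idm {_} A.
Arguments comp {_} {_ _ _} _ _.

Notation "g ∘ f" := (comp g f) (at level 40, left associativity) : cat_scope.

Record Functor (A B : Category) := {
  fob :> A -> B;
  fmap : forall X Y : A, Hom X Y -> Hom (fob X) (fob Y);
  fmap_id : forall X : A, fmap (idm X) = idm (fob X);
  fmap_comp : forall (X Y Z : A) (g : Hom Y Z) (f : Hom X Y),
    fmap (g ∘ f) = fmap g ∘ fmap f
}.

Arguments fmap {_ _} _ {_ _} _.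

(** Naturality, in both variables jointly, of a family
    [Hom_B (F -, F -) -> Hom_A (-, -)]. *)
Definition hom_natural (A B : Category) (F : Functor A B)
    (P : forall X Y : A, Hom (F X) (F Y) -> Hom X Y) : Prop :=
  forall (X X' Y Y' : A) (u : Hom X' X) (v : Hom Y Y') (g : Hom (F X) (F Y)),
    P X' Y' (fmap F v ∘ g ∘ fmap F u) = v ∘ P X Y g ∘ u.

Definition separable (A B : Category) (F : Functor A B) : Prop :=
  exists P : forall X Y : A, Hom (F X) (F Y) -> Hom X Y,
    hom_natural P /\ (forall (X Y : A) (f : Hom X Y), P X Y (fmap F f) = f).

Definition is_equalizer (K : Category) (X Y : K) (f g : Hom X Y)
    (E : K) (e : Hom E X) : Prop :=
  f ∘ e = g ∘ e /\
  forall (Z : K) (h : Hom Z X), f ∘ h = g ∘ h -> exists! k : Hom Z E, e ∘ k = h.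

(** Chosen equalizers, as the coinduction functor depends on the choice. *)
Record Equalizers (K : Category) := {
  eq_ob : forall (X Y : K) (f g : Hom X Y), K;
  eq_arr : forall (X Y : K) (f g : Hom X Y), Hom (eq_ob f g) X;
  eq_arrP : forall (X Y : K) (f g : Hom X Y), is_equalizer f g (eq_arr f g)
}.

Arguments eq_ob {_} _ {_ _} f g.
Arguments eq_arr {_} _ {_ _} f g.
Arguments eq_arrP {_} _ {_ _} f g.

Definition eq_lift (K : Category) (X Y : K) (f g : Hom X Y) (E : K)
    (e : Hom E X) (eP : is_equalizer f g e) (Z : K) (h : Hom Z X)
    (hP : f ∘ h = g ∘ h) : Hom Z E :=
  proj1_sig (constructive_definite_description _ (proj2 eP Z h hP)).

Lemma eq_lift_comp (K : Category) (X Y : K) (f g : Hom X Y) (E : K)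
    (e : Hom E X) (eP : is_equalizer f g e) (Z : K) (h : Hom Z X)
    (hP : f ∘ h = g ∘ h) : e ∘ eq_lift eP hP = h.
Proof. by rewrite /eq_lift; case: constructive_definite_description. Qed.

Lemma equalizer_mono (K : Category) (X Y : K) (f g : Hom X Y) (E : K)
    (e : Hom E X) (eP : is_equalizer f g e) (Z : K) (h k : Hom Z E) :
  e ∘ h = e ∘ k -> h = k.
Proof.
move=> ehk; case: eP => fe eP.
have hP : f ∘ (e ∘ h) = g ∘ (e ∘ h) by rewrite !comp_assoc fe.
case: (eP _ _ hP) => x [_ xuniq].
by rewrite -(xuniq h) // -(xuniq k).
Qed.

Record MonoidalCategory := {
  mcat :> Category;
  tens : mcat -> mcat -> mcat;
  tensm : forall A A' B B' : mcat,
    Hom A A' -> Hom B B' -> Hom (tens A B) (tens A' B');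
  tensm_id : forall A B : mcat, tensm (idm A) (idm B) = idm (tens A B);
  tensm_comp : forall (A A' A'' B B' B'' : mcat)
      (f' : Hom A' A'') (f : Hom A A') (g' : Hom B' B'') (g : Hom B B'),
    tensm (f' ∘ f) (g' ∘ g) = tensm f' g' ∘ tensm f g;
  unit_ob : mcat;
  asc : forall A B C : mcat, Hom (tens (tens A B) C) (tens A (tens B C));
  asc_inv : forall A B C : mcat, Hom (tens A (tens B C)) (tens (tens A B) C);
  lun : forall A : mcat, Hom (tens unit_ob A) A;
  lun_inv : forall A : mcat, Hom A (tens unit_ob A);
  run : forall A : mcat, Hom (tens A unit_ob) A;
  run_inv : forall A : mcat, Hom A (tens A unit_ob);
  asc_ascK : forall A B C : mcat, asc_inv A B C ∘ asc A B C = idm _;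
  asc_invK : forall A B C : mcat, asc A B C ∘ asc_inv A B C = idm _;
  lun_lunK : forall A : mcat, lun_inv A ∘ lun A = idm _;
  lun_invK : forall A : mcat, lun A ∘ lun_inv A = idm _;
  run_runK : forall A : mcat, run_inv A ∘ run A = idm _;
  run_invK : forall A : mcat, run A ∘ run_inv A = idm _;
  asc_nat : forall (A A' B B' C C' : mcat)
      (f : Hom A A') (g : Hom B B') (h : Hom C C'),
    asc A' B' C' ∘ tensm (tensm f g) h = tensm f (tensm g h) ∘ asc A B C;
  lun_nat : forall (A A' : mcat) (f : Hom A A'),
    lun A' ∘ tensm (idm unit_ob) f = f ∘ lun A;
  run_nat : forall (A A' : mcat) (f : Hom A A'),
    run A' ∘ tensm f (idm unit_ob) = f ∘ run A;
  triangle : forall A B : mcat,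
    tensm (idm A) (lun B) ∘ asc A unit_ob B = tensm (run A) (idm B);
  pentagon : forall A B C D : mcat,
    asc A B (tens C D) ∘ asc (tens A B) C D =
    tensm (idm A) (asc B C D) ∘ asc A (tens B C) D ∘ tensm (asc A B C) (idm D)
}.

Arguments tens {_} _ _.
Arguments tensm {_} {_ _ _ _} _ _.
Arguments unit_ob {_}.
Arguments asc {_} _ _ _.
Arguments asc_inv {_} _ _ _.
Arguments lun {_} _.
Arguments lun_inv {_} _.
Arguments run {_} _.
Arguments run_inv {_} _.

Notation "A ⊗ B" := (tens A B) (at level 34, left associativity) : cat_scope.
Notation "f ⊠ g" := (tensm f g) (at level 34, left associativity) : cat_scope.

Definition flat (K : MonoidalCategory) (X : K) : Prop :=
  forall (A B : K) (f g : Hom A B) (E : K) (e : Hom E A),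
    is_equalizer f g e ->
    is_equalizer (idm X ⊠ f) (idm X ⊠ g) (idm X ⊠ e) /\
    is_equalizer (f ⊠ idm X) (g ⊠ idm X) (e ⊠ idm X).

Definition left_tensor_cogenerator (K : MonoidalCategory) (Q : K) : Prop :=
  forall (Y Z W : K) (f g : Hom Y (Z ⊗ W)),
    (forall xi : Hom Z Q, (xi ⊠ idm W) ∘ f = (xi ⊠ idm W) ∘ g) -> f = g.

Section MonoidalFacts.
Context (K : MonoidalCategory).
Implicit Types X Y Z A B C : K.

Lemma tensm_lr A A' B B' (f : Hom A A') (g : Hom B B') :
  f ⊠ g = (f ⊠ idm B') ∘ (idm A ⊠ g).
Proof. by rewrite -tensm_comp comp_id_l comp_id_r. Qed.

Lemma tensm_rl A A' B B' (f : Hom A A') (g : Hom B B') :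
  f ⊠ g = (idm A' ⊠ g) ∘ (f ⊠ idm B).
Proof. by rewrite -tensm_comp comp_id_l comp_id_r. Qed.

Lemma tensm_swap A A' B B' (f : Hom A A') (g : Hom B B') :
  (f ⊠ idm B') ∘ (idm A ⊠ g) = (idm A' ⊠ g) ∘ (f ⊠ idm B).
Proof. by rewrite -tensm_lr tensm_rl. Qed.

Lemma tensm_compl A A' A'' B (g : Hom A' A'') (f : Hom A A') :
  (g ∘ f) ⊠ idm B = (g ⊠ idm B) ∘ (f ⊠ idm B).
Proof. by rewrite -tensm_comp comp_id_l. Qed.

Lemma tensm_compr A A' A'' B (g : Hom A' A'') (f : Hom A A') :
  idm B ⊠ (g ∘ f) = (idm B ⊠ g) ∘ (idm B ⊠ f).
Proof. by rewrite -tensm_comp comp_id_l. Qed.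

Lemma asc_inj X A B C (f g : Hom X (A ⊗ B ⊗ C)) :
  asc A B C ∘ f = asc A B C ∘ g -> f = g.
Proof.
move=> fg; rewrite -[f]comp_id_l -[g]comp_id_l -asc_ascK.
by rewrite -!comp_assoc fg.
Qed.

Lemma run_faithful A B (f g : Hom A B) :
  f ⊠ idm unit_ob = g ⊠ idm unit_ob -> f = g.
Proof.
move=> fg; rewrite -[f]comp_id_r -[g]comp_id_r -run_invK.
by rewrite !comp_assoc -!run_nat fg.
Qed.

Lemma run_tens A B : (idm A ⊠ run B) ∘ asc A B unit_ob = run (A ⊗ B).
Proof.
apply: run_faithful; apply: asc_inj.
rewrite tensm_compl comp_assoc asc_nat -triangle tensm_compr.
rewrite -!comp_assoc [_ ∘ (asc _ _ _ ∘ _)]comp_assoc -pentagon.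
by rewrite -(triangle (A ⊗ B)) !comp_assoc -asc_nat tensm_id.
Qed.

End MonoidalFacts.

Record Coalgebra (K : MonoidalCategory) := {
  coalg_ob :> K;
  comul : Hom coalg_ob (coalg_ob ⊗ coalg_ob);
  counit : Hom coalg_ob unit_ob;
  comul_coassoc :
    asc coalg_ob coalg_ob coalg_ob ∘ (comul ⊠ idm coalg_ob) ∘ comul =
    (idm coalg_ob ⊠ comul) ∘ comul;
  comul_counitl : lun coalg_ob ∘ (counit ⊠ idm coalg_ob) ∘ comul = idm coalg_ob;
  comul_counitr : run coalg_ob ∘ (idm coalg_ob ⊠ counit) ∘ comul = idm coalg_ob
}.

Arguments comul {_} _.
Arguments counit {_} _.

Record CoalgHom (K : MonoidalCategory) (C D : Coalgebra K) := {
  coalg_map :> Hom C D;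
  coalg_map_comul : (coalg_map ⊠ coalg_map) ∘ comul C = comul D ∘ coalg_map;
  coalg_map_counit : counit D ∘ coalg_map = counit C
}.

Definition right_coaction (K : MonoidalCategory) (C : Coalgebra K) (V : K)
    (rho : Hom V (V ⊗ C)) : Prop :=
  asc V C C ∘ (rho ⊠ idm C) ∘ rho = (idm V ⊠ comul C) ∘ rho /\
  run V ∘ (idm V ⊠ counit C) ∘ rho = idm V.

Definition left_coaction (K : MonoidalCategory) (C : Coalgebra K) (W : K)
    (lam : Hom W (C ⊗ W)) : Prop :=
  (idm C ⊠ lam) ∘ lam = asc C C W ∘ (comul C ⊠ idm W) ∘ lam /\
  lun W ∘ (counit C ⊠ idm W) ∘ lam = idm W.

Record RComod (K : MonoidalCategory) (C : Coalgebra K) := {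
  rcomod_ob :> K;
  rcoact : Hom rcomod_ob (rcomod_ob ⊗ C);
  rcoactP : right_coaction rcoact
}.

Arguments rcoact {_ _} _.

Record LComod (K : MonoidalCategory) (C : Coalgebra K) := {
  lcomod_ob :> K;
  lcoact : Hom lcomod_ob (C ⊗ lcomod_ob);
  lcoactP : left_coaction lcoact
}.

Arguments lcoact {_ _} _.

Record Bicomod (K : MonoidalCategory) (D : Coalgebra K) := {
  bicomod_ob :> K;
  bi_lcoact : Hom bicomod_ob (D ⊗ bicomod_ob);
  bi_rcoact : Hom bicomod_ob (bicomod_ob ⊗ D);
  bi_lcoactP : left_coaction bi_lcoact;
  bi_rcoactP : right_coaction bi_rcoact;
  bi_compat : asc D bicomod_ob D ∘ (bi_lcoact ⊠ idm D) ∘ bi_rcoact =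
              (idm D ⊠ bi_rcoact) ∘ bi_lcoact
}.

Arguments bi_lcoact {_ _} _.
Arguments bi_rcoact {_ _} _.

Record BicomodHom (K : MonoidalCategory) (D : Coalgebra K) (V W : Bicomod D) := {
  bicomod_map :> Hom V W;
  bicomod_map_l : bi_lcoact W ∘ bicomod_map = (idm D ⊠ bicomod_map) ∘ bi_lcoact V;
  bicomod_map_r : bi_rcoact W ∘ bicomod_map = (bicomod_map ⊠ idm D) ∘ bi_rcoact V
}.

Record RComodHom (K : MonoidalCategory) (C : Coalgebra K) (V W : RComod C) := {
  rcomod_map :> Hom V W;
  rcomod_mapP : rcoact W ∘ rcomod_map = (rcomod_map ⊠ idm C) ∘ rcoact V
}.

Lemma rcomod_hom_eq (K : MonoidalCategory) (C : Coalgebra K) (V W : RComod C)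
    (f g : RComodHom V W) : rcomod_map f = rcomod_map g -> f = g.
Proof.
case: f g => [f fP] [g gP] /= fg; subst g.
by rewrite (proof_irrelevance _ fP gP).
Qed.

Lemma rcomod_idP (K : MonoidalCategory) (C : Coalgebra K) (V : RComod C) :
  rcoact V ∘ idm V = (idm V ⊠ idm C) ∘ rcoact V.
Proof. by rewrite tensm_id comp_id_l comp_id_r. Qed.

Definition rcomod_id (K : MonoidalCategory) (C : Coalgebra K) (V : RComod C) :
  RComodHom V V := {| rcomod_mapP := rcomod_idP V |}.

Lemma rcomod_compP (K : MonoidalCategory) (C : Coalgebra K) (U V W : RComod C)
    (g : RComodHom V W) (f : RComodHom U V) :
  rcoact W ∘ (g ∘ f) = ((g ∘ f) ⊠ idm C) ∘ rcoact U.
Proof.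
by rewrite comp_assoc rcomod_mapP -comp_assoc rcomod_mapP comp_assoc tensm_compl.
Qed.

Definition rcomod_comp (K : MonoidalCategory) (C : Coalgebra K) (U V W : RComod C)
    (g : RComodHom V W) (f : RComodHom U V) : RComodHom U W :=
  {| rcomod_mapP := rcomod_compP g f |}.

Lemma rcomod_comp_assoc (K : MonoidalCategory) (C : Coalgebra K)
    (T U V W : RComod C)
    (h : RComodHom V W) (g : RComodHom U V) (f : RComodHom T U) :
  rcomod_comp h (rcomod_comp g f) = rcomod_comp (rcomod_comp h g) f.
Proof. by apply: rcomod_hom_eq; apply: comp_assoc. Qed.

Lemma rcomod_comp_id_l (K : MonoidalCategory) (C : Coalgebra K)
    (V W : RComod C) (f : RComodHom V W) : rcomod_comp (rcomod_id W) f = f.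
Proof. by apply: rcomod_hom_eq; apply: comp_id_l. Qed.

Lemma rcomod_comp_id_r (K : MonoidalCategory) (C : Coalgebra K)
    (V W : RComod C) (f : RComodHom V W) : rcomod_comp f (rcomod_id V) = f.
Proof. by apply: rcomod_hom_eq; apply: comp_id_r. Qed.

Definition RComodCat (K : MonoidalCategory) (C : Coalgebra K) : Category := {|
  Ob := RComod C;
  Hom := @RComodHom K C;
  idm := @rcomod_id K C;
  comp := @rcomod_comp K C;
  comp_assoc := @rcomod_comp_assoc K C;
  comp_id_l := @rcomod_comp_id_l K C;
  comp_id_r := @rcomod_comp_id_r K C
|}.

Definition regular_bicomod (K : MonoidalCategory) (D : Coalgebra K) : Bicomod D := {|
  bicomod_ob := D;
  bi_lcoact := comul D;
  bi_rcoact := comul D;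
  bi_lcoactP := conj (eq_sym (comul_coassoc D)) (comul_counitl D);
  bi_rcoactP := conj (comul_coassoc D) (comul_counitr D);
  bi_compat := comul_coassoc D
|}.

Section CoalgBicomod.
Context (K : MonoidalCategory) (C D : Coalgebra K) (psi : CoalgHom C D).

Lemma psi_lcoactP : left_coaction ((psi ⊠ idm C) ∘ comul C).
Proof.
split.
- rewrite !comp_assoc -tensm_comp comp_id_l comp_id_r.
  rewrite -[_ ∘ (psi ⊠ _)]comp_assoc -tensm_comp comp_id_l -coalg_map_comul.
  rewrite tensm_compl comp_assoc asc_nat -!comp_assoc.
  rewrite [asc _ _ _ ∘ _]comp_assoc comul_coassoc !comp_assoc.
  by rewrite -tensm_comp comp_id_r.
- rewrite !comp_assoc -[lun C ∘ _ ∘ _]comp_assoc -tensm_compl.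
  by rewrite coalg_map_counit comul_counitl.
Qed.

Lemma psi_rcoactP : right_coaction ((idm C ⊠ psi) ∘ comul C).
Proof.
split.
- rewrite !comp_assoc -[_ ∘ (idm C ⊠ psi)]comp_assoc -tensm_comp.
  rewrite comp_id_l comp_id_r -tensm_compr -coalg_map_comul tensm_compr.
  rewrite -[in RHS]comp_assoc -comul_coassoc !comp_assoc -asc_nat.
  by rewrite -[in RHS](comp_assoc (asc _ _ _)) -tensm_comp comp_id_r.
- rewrite !comp_assoc -[run C ∘ _ ∘ _]comp_assoc -tensm_compr.
  by rewrite coalg_map_counit comul_counitr.
Qed.

Lemma psi_compat :
  asc D C D ∘ (((psi ⊠ idm C) ∘ comul C) ⊠ idm D) ∘ ((idm C ⊠ psi) ∘ comul C) =
  (idm D ⊠ ((idm C ⊠ psi) ∘ comul C)) ∘ ((psi ⊠ idm C) ∘ comul C).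
Proof.
rewrite !comp_assoc -tensm_comp comp_id_l comp_id_r.
rewrite -[_ ∘ (idm C ⊠ psi)]comp_assoc -tensm_comp comp_id_l comp_id_r.
have -> : ((psi ⊠ idm C) ∘ comul C) ⊠ psi =
          (psi ⊠ idm C ⊠ psi) ∘ (comul C ⊠ idm C).
  by rewrite -tensm_comp comp_id_r.
rewrite comp_assoc asc_nat -!comp_assoc.
rewrite [asc _ _ _ ∘ _]comp_assoc comul_coassoc !comp_assoc.
by rewrite -tensm_comp comp_id_r.
Qed.

Definition coalg_bicomod : Bicomod D := {|
  bicomod_ob := C;
  bi_lcoactP := psi_lcoactP;
  bi_rcoactP := psi_rcoactP;
  bi_compat := psi_compat
|}.

End CoalgBicomod.

Definition lcomod_of_bicomod (K : MonoidalCategory) (D : Coalgebra K)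
    (V : Bicomod D) : LComod D :=
  {| lcomod_ob := V; lcoactP := bi_lcoactP V |}.

Definition cotensor (K : MonoidalCategory) (eqz : Equalizers K) (C : Coalgebra K)
    (V : RComod C) (W : LComod C) : K :=
  eq_ob eqz (asc V C W ∘ (rcoact V ⊠ idm W)) (idm V ⊠ lcoact W).

Definition cotensor_arr (K : MonoidalCategory) (eqz : Equalizers K)
    (C : Coalgebra K) (V : RComod C) (W : LComod C) :
    Hom (cotensor eqz V W) (V ⊗ W) :=
  eq_arr eqz (asc V C W ∘ (rcoact V ⊠ idm W)) (idm V ⊠ lcoact W).

Section Coinduction.
Context (K : MonoidalCategory) (eqz : Equalizers K) (flatK : forall X : K, flat X).
Context (C D : Coalgebra K) (psi : CoalgHom C D).

Local Notation CL := (lcomod_of_bicomod (coalg_bicomod psi)).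

Definition coind_ob (M : RComod D) : K := cotensor eqz M CL.

Definition coind_arr (M : RComod D) : Hom (coind_ob M) (M ⊗ C) :=
  cotensor_arr eqz M CL.

Local Notation e := coind_arr.

Definition coind_arrP (M : RComod D) :
    is_equalizer (asc M D C ∘ (rcoact M ⊠ idm C)) (idm M ⊠ lcoact CL) (e M) :=
  eq_arrP eqz _ _.

Lemma coind_arrE (M : RComod D) :
  asc M D C ∘ (rcoact M ⊠ idm C) ∘ e M = (idm M ⊠ lcoact CL) ∘ e M.
Proof. by case: (coind_arrP M). Qed.

Lemma lcoact_comul :
  (idm D ⊠ comul C) ∘ lcoact CL = asc D C C ∘ (lcoact CL ⊠ idm C) ∘ comul C.
Proof.
rewrite /= !comp_assoc -tensm_comp comp_id_l comp_id_r.
rewrite tensm_compl !comp_assoc asc_nat tensm_id -!comp_assoc.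
rewrite [asc _ _ _ ∘ _]comp_assoc comul_coassoc !comp_assoc.
by rewrite -tensm_comp comp_id_l comp_id_r.
Qed.

(** The right-hand side of the equation characterizing the coaction of
    [M □_D C], reassociated so as to land in [(M ⊗ C) ⊗ C]. *)
Definition coind_pre (M : RComod D) : Hom (coind_ob M) (M ⊗ C ⊗ C) :=
  asc_inv M C C ∘ ((idm M ⊠ comul C) ∘ e M).

Lemma asc_coind_pre (M : RComod D) :
  asc M C C ∘ coind_pre M = (idm M ⊠ comul C) ∘ e M.
Proof. by rewrite /coind_pre comp_assoc asc_invK comp_id_l. Qed.

Lemma coind_preP (M : RComod D) :
  ((asc M D C ∘ (rcoact M ⊠ idm C)) ⊠ idm C) ∘ coind_pre M =
  ((idm M ⊠ lcoact CL) ⊠ idm C) ∘ coind_pre M.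
Proof.
apply: asc_inj.
have inj X (f g : Hom X (M ⊗ (D ⊗ C ⊗ C))) :
    (idm M ⊠ asc D C C) ∘ f = (idm M ⊠ asc D C C) ∘ g -> f = g.
  move=> fg; rewrite -[f]comp_id_l -[g]comp_id_l -tensm_id -asc_ascK.
  by rewrite tensm_compr -!comp_assoc fg.
apply: inj.
rewrite tensm_compl !comp_assoc -pentagon.
rewrite -[_ ∘ (rcoact M ⊠ idm C ⊠ idm C)]comp_assoc asc_nat tensm_id.
rewrite -!comp_assoc asc_coind_pre.
rewrite [(rcoact M ⊠ _) ∘ _]comp_assoc tensm_swap -[in LHS]comp_assoc.
rewrite [asc _ _ _ ∘ _]comp_assoc -(tensm_id M D) asc_nat.
rewrite -[in LHS]comp_assoc [asc _ _ _ ∘ (_ ∘ e M)]comp_assoc coind_arrE.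
rewrite [asc _ _ _ ∘ _ in RHS]comp_assoc asc_nat.
rewrite -[in RHS]comp_assoc asc_coind_pre !comp_assoc -!tensm_compr.
by rewrite lcoact_comul.
Qed.

Definition coind_coact (M : RComod D) : Hom (coind_ob M) (coind_ob M ⊗ C) :=
  eq_lift (proj2 (flatK C (coind_arrP M))) (coind_preP M).

Lemma coind_coactE (M : RComod D) :
  asc M C C ∘ (e M ⊠ idm C) ∘ coind_coact M = (idm M ⊠ comul C) ∘ e M.
Proof. by rewrite -comp_assoc eq_lift_comp asc_coind_pre. Qed.

Lemma coind_coact_unique (M : RComod D) (r : Hom (coind_ob M) (coind_ob M ⊗ C)) :
  asc M C C ∘ (e M ⊠ idm C) ∘ r = (idm M ⊠ comul C) ∘ e M -> r = coind_coact M.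
Proof.
rewrite -coind_coactE -!comp_assoc => /asc_inj.
exact: (equalizer_mono (proj2 (flatK C (coind_arrP M)))).
Qed.

Lemma coind_coactP (M : RComod D) : right_coaction (coind_coact M).
Proof.
split.
- apply: (equalizer_mono (proj2 (flatK (C ⊗ C) (coind_arrP M)))).
  apply: asc_inj.
  rewrite !comp_assoc.
  rewrite -[_ ∘ (e M ⊠ _) ∘ asc _ _ _]comp_assoc -(tensm_id C C) -asc_nat.
  rewrite comp_assoc pentagon.
  rewrite -[_ ∘ (e M ⊠ idm C ⊠ idm C)]comp_assoc -tensm_compl.
  rewrite -[_ ∘ (coind_coact M ⊠ idm C)]comp_assoc -tensm_compl coind_coactE.
  rewrite tensm_compl !comp_assoc -[_ ∘ (idm M ⊠ comul C ⊠ idm C)]comp_assoc.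
  rewrite asc_nat -!comp_assoc [asc _ _ _ ∘ _ in LHS]comp_assoc coind_coactE.
  rewrite !comp_assoc -!tensm_compr comul_coassoc.
  rewrite -[asc _ _ _ ∘ _ ∘ _ in RHS]comp_assoc tensm_id tensm_swap.
  rewrite comp_assoc -(tensm_id M C) asc_nat -!comp_assoc.
  rewrite [asc _ _ _ ∘ _ in RHS]comp_assoc coind_coactE.
  by rewrite comp_assoc tensm_compr.
- apply: (equalizer_mono (coind_arrP M)).
  rewrite comp_id_r !comp_assoc -run_nat.
  rewrite -[run _ ∘ _ ∘ _]comp_assoc tensm_swap -run_tens.
  rewrite !comp_assoc -[_ ∘ asc _ _ _ ∘ _]comp_assoc -(tensm_id M C) asc_nat.
  rewrite -!comp_assoc [asc _ _ _ ∘ _]comp_assoc coind_coactE.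
  by rewrite !comp_assoc -!tensm_compr comul_counitr tensm_id comp_id_l.
Qed.

Definition coind_comod (M : RComod D) : RComod C :=
  {| rcomod_ob := coind_ob M; rcoactP := coind_coactP M |}.

Lemma coind_map_pre (M N : RComod D) (f : RComodHom M N) :
  asc N D C ∘ (rcoact N ⊠ idm C) ∘ ((f ⊠ idm C) ∘ e M) =
  (idm N ⊠ lcoact CL) ∘ ((f ⊠ idm C) ∘ e M).
Proof.
rewrite !comp_assoc -[asc _ _ _ ∘ _ ∘ _]comp_assoc -tensm_compl rcomod_mapP.
rewrite tensm_compl comp_assoc asc_nat tensm_id -!comp_assoc.
by rewrite [asc _ _ _ ∘ _]comp_assoc coind_arrE !comp_assoc tensm_swap.
Qed.

Definition coind_map (M N : RComod D) (f : RComodHom M N) :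
    Hom (coind_ob M) (coind_ob N) :=
  eq_lift (coind_arrP N) (coind_map_pre f).

Lemma coind_mapE (M N : RComod D) (f : RComodHom M N) :
  e N ∘ coind_map f = (f ⊠ idm C) ∘ e M.
Proof. exact: eq_lift_comp. Qed.

Lemma coind_map_unique (M N : RComod D) (f : RComodHom M N)
    (k : Hom (coind_ob M) (coind_ob N)) :
  e N ∘ k = (f ⊠ idm C) ∘ e M -> k = coind_map f.
Proof. by rewrite -coind_mapE; apply: (equalizer_mono (coind_arrP N)). Qed.

Lemma coind_mapP (M N : RComod D) (f : RComodHom M N) :
  coind_coact N ∘ coind_map f = (coind_map f ⊠ idm C) ∘ coind_coact M.
Proof.
apply: (equalizer_mono (proj2 (flatK C (coind_arrP N)))); apply: asc_inj.
rewrite !comp_assoc coind_coactE -comp_assoc coind_mapE comp_assoc -tensm_swap.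
rewrite -[in RHS](comp_assoc (asc _ _ _)) -tensm_compl coind_mapE tensm_compl.
rewrite comp_assoc asc_nat tensm_id -!comp_assoc.
by rewrite [asc _ _ _ ∘ _]comp_assoc coind_coactE.
Qed.

Definition coind_hom (M N : RComod D) (f : RComodHom M N) :
    RComodHom (coind_comod M) (coind_comod N) :=
  @Build_RComodHom K C (coind_comod M) (coind_comod N) (coind_map f) (coind_mapP f).

Lemma coind_hom_id (M : RComod D) :
  coind_hom (rcomod_id M) = rcomod_id (coind_comod M).
Proof.
apply: rcomod_hom_eq; symmetry; apply: coind_map_unique.
by rewrite /= tensm_id comp_id_l comp_id_r.
Qed.

Lemma coind_hom_comp (M N P : RComod D) (g : RComodHom N P) (f : RComodHom M N) :
  coind_hom (rcomod_comp g f) = rcomod_comp (coind_hom g) (coind_hom f).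
Proof.
apply: rcomod_hom_eq; symmetry; apply: coind_map_unique => /=.
by rewrite comp_assoc coind_mapE -comp_assoc coind_mapE comp_assoc tensm_compl.
Qed.

Definition coinduction : Functor (RComodCat D) (RComodCat C) := {|
  fob := coind_comod : RComodCat D -> RComodCat C;
  fmap := coind_hom : forall M N : RComodCat D,
    Hom M N -> Hom (coind_comod M : RComodCat C) (coind_comod N);
  fmap_id := coind_hom_id;
  fmap_comp := coind_hom_comp
|}.

End Coinduction.

Definition bicomod_split_epi (K : MonoidalCategory) (C D : Coalgebra K)
    (psi : CoalgHom C D) : Prop :=
  exists chi : BicomodHom (regular_bicomod D) (coalg_bicomod psi),
    psi ∘ chi = idm D.

Definition bicomod_counit_section (K : MonoidalCategory) (C D : Coalgebra K)
    (psi : CoalgHom C D) : Prop :=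
  exists chi : BicomodHom (regular_bicomod D) (coalg_bicomod psi),
    counit C ∘ chi = counit D.

(* Main.v *)
(** The coinduction functor is right adjoint to the corestriction functor
    [V ↦ (V, (V ⊗ ψ) ρ)], so by Rafael's theorem it is separable iff the counit
    [M □_D C -> M] has a natural section [σ].  A bicomodule map [χ : D -> C]
    with [ε_C χ = ε_D] gives the section with [e σ_M = (M ⊗ χ) ρ_M].
    Conversely, [χ] is [σ_D] followed by [D □_D C ≅ C]; it is automatically right
    [D]-colinear, and left colinearity is naturality of [σ] along
    [Δ : D -> D ⊗ D], once [σ] at the free comodule [D ⊗ D] is known to be
    [D ⊗ σ_D]; this is what the cogenerator hypothesis provides. *)

Require Import Defs.
From Stdlib Require Import ssreflect.

Set Implicit Arguments.
Unset Strict Implicit.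
Unset Printing Implicit Defensive.

(** * Rewriting the head of a right-nested composite *)

Lemma precomp (K : Category) (W X Y Z : K) (g : Hom Y Z) (f : Hom X Y)
    (h : Hom X Z) (k : Hom W X) : g ∘ f = h -> g ∘ (f ∘ k) = h ∘ k.
Proof. by rewrite comp_assoc => ->. Qed.

Lemma precomp2 (K : Category) (W X Y T Z : K) (g : Hom Y Z) (f : Hom X Y)
    (g' : Hom T Z) (f' : Hom X T) (k : Hom W X) :
  g ∘ f = g' ∘ f' -> g ∘ (f ∘ k) = g' ∘ (f' ∘ k).
Proof. by rewrite !comp_assoc => ->. Qed.

(** * Rafael's criterion for separability of a right adjoint *)

Section Rafael.
Context (A B : Category) (R : Functor A B) (L : Functor B A).
Context (eps : forall M : A, Hom (L (R M)) M).
Hypothesis eps_nat : forall (M N : A) (u : Hom M N),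
  eps N ∘ fmap L (fmap R u) = u ∘ eps M.

Definition natural_section (s : forall M : A, Hom M (L (R M))) : Prop :=
  (forall (M N : A) (u : Hom M N), s N ∘ u = fmap L (fmap R u) ∘ s M) /\
  (forall M : A, eps M ∘ s M = idm M).

(** For [g = fmap R f], naturality of [eps] moves [f] to the front of the witness and leaves
    [eps ∘ s], which is the identity. *)
Lemma natural_section_separable (s : forall M : A, Hom M (L (R M))) :
  natural_section s -> separable R.
Proof.
case=> s_nat epsK.
exists (fun M N g => eps N ∘ fmap L g ∘ s M); split.
- move=> X X' Y Y' u v g; rewrite !fmap_comp -!comp_assoc -s_nat.
  by rewrite (precomp2 _ (eps_nat v)).
- by move=> X Y f; rewrite eps_nat -comp_assoc epsK comp_id_r.
Qed.

Context (eta : forall V : B, Hom V (R (L V))).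
Hypothesis eta_nat : forall (V W : B) (g : Hom V W),
  eta W ∘ g = fmap R (fmap L g) ∘ eta V.
Hypothesis triangle_R : forall M : A, fmap R (eps M) ∘ eta (R M) = idm (R M).

(** The section is [P] applied to the unit at [R M]. Naturality of [P], one variable at a time,
    turns its naturality square into [P] of the square for [eta], and turns [eps ∘ s] into [P] of a
    triangle identity, that is [P] of an identity. *)
Lemma separable_natural_section :
  separable R -> exists s, natural_section s.
Proof.
case=> P [P_nat PK]; exists (fun M => P _ _ (eta (R M))); split.
- move=> M N u.
  have := P_nat _ _ _ _ u (idm _) (eta (R N)).
  rewrite fmap_id !comp_id_l => <-.
  have := P_nat _ _ _ _ (idm _) (fmap L (fmap R u)) (eta (R M)).
  by rewrite fmap_id !comp_id_r => <-; rewrite eta_nat.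
- move=> M; have := P_nat _ _ _ _ (idm _) (eps M) (eta (R M)).
  by rewrite fmap_id !comp_id_r triangle_R => <-; rewrite -fmap_id PK.
Qed.

End Rafael.

(** * Coherence of the unit constraints *)

Section MonoidalLemmas.
Context (K : MonoidalCategory).
Implicit Types A B X : K.

Lemma tensm_compl2 A A' A'' B B' (g : Hom A' A'') (f : Hom A A') (h : Hom B B') :
  (g ∘ f) ⊠ h = (g ⊠ h) ∘ (f ⊠ idm B).
Proof. by rewrite -tensm_comp comp_id_r. Qed.

Lemma lun_inj A X (f g : Hom X (unit_ob ⊗ A)) : lun A ∘ f = lun A ∘ g -> f = g.
Proof.
move=> fg; rewrite -[f]comp_id_l -[g]comp_id_l -lun_lunK.
by rewrite -!comp_assoc fg.
Qed.

Lemma lun_faithful A B (f g : Hom A B) :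
  idm unit_ob ⊠ f = idm unit_ob ⊠ g -> f = g.
Proof.
move=> fg; rewrite -[f]comp_id_r -[g]comp_id_r -lun_invK.
by rewrite !comp_assoc -!lun_nat fg.
Qed.

Lemma asc_epi A B C X (f g : Hom (A ⊗ (B ⊗ C)) X) :
  f ∘ asc A B C = g ∘ asc A B C -> f = g.
Proof.
move=> fg; rewrite -[f]comp_id_r -[g]comp_id_r -asc_invK.
by rewrite !comp_assoc fg.
Qed.

Lemma ascr_epi A B C D X (f g : Hom (A ⊗ (B ⊗ C) ⊗ D) X) :
  f ∘ (asc A B C ⊠ idm D) = g ∘ (asc A B C ⊠ idm D) -> f = g.
Proof.
move=> fg; rewrite -[f]comp_id_r -[g]comp_id_r -tensm_id -asc_invK tensm_compl.
by rewrite !comp_assoc fg.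
Qed.

(** Kelly's argument: after tensoring with the unit on the left and precomposing with invertible
    associators, the claim follows from the pentagon on [unit_ob, unit_ob, A, B] and two
    triangles. *)
Lemma lun_tens A B : lun (A ⊗ B) ∘ asc unit_ob A B = lun A ⊠ idm B.
Proof.
apply: lun_faithful; apply: asc_epi; apply: ascr_epi.
rewrite tensm_compr -!comp_assoc.
have := pentagon unit_ob unit_ob A B; rewrite -!comp_assoc => <-.
rewrite comp_assoc triangle -(tensm_id A B) -asc_nat.
by rewrite (comp_assoc (idm _ ⊠ _)) -asc_nat -comp_assoc -tensm_compl triangle.
Qed.

(** Tensored with the unit on the right, the two sides become [lun] at [unit_ob ⊗ unit_ob] and
    [idm unit_ob ⊠ lun unit_ob], each after the associator. These agree by naturality of [lun] at
    [lun] itself. *)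
Lemma lun_run_unit : lun unit_ob = run unit_ob :> Hom (unit_ob ⊗ unit_ob : K) _.
Proof.
apply: run_faithful; rewrite -lun_tens -triangle; congr (_ ∘ _).
by apply: lun_inj; rewrite lun_nat.
Qed.

End MonoidalLemmas.

(** * Corestriction of comodules along [psi] *)

Section Corestriction.
Context (K : MonoidalCategory) (C D : Coalgebra K) (psi : CoalgHom C D).

Definition corestr_coact (V : RComod C) : Hom V (V ⊗ D) :=
  (idm V ⊠ psi) ∘ rcoact V.

Lemma corestr_coactP (V : RComod C) : right_coaction (corestr_coact V).
Proof.
case: (rcoactP V) => assocV unitV; split; rewrite /corestr_coact.
- rewrite -!comp_assoc (precomp _ (eq_sym (tensm_comp _ _ _ _))).
  rewrite comp_id_l comp_id_r tensm_compl2 -!comp_assoc.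
  rewrite (precomp2 _ (asc_nat _ _ _)).
  rewrite (comp_assoc (asc _ _ _)) assocV !comp_assoc -!tensm_compr.
  by rewrite coalg_map_comul.
- rewrite -!comp_assoc (precomp _ (eq_sym (tensm_compr _ _ _))) coalg_map_counit.
  by rewrite comp_assoc.
Qed.

Definition corestr_ob (V : RComod C) : RComod D :=
  {| rcomod_ob := V; rcoactP := corestr_coactP V |}.

Lemma corestr_homP (V W : RComod C) (f : RComodHom V W) :
  rcoact (corestr_ob W) ∘ f = (f ⊠ idm D) ∘ rcoact (corestr_ob V).
Proof.
rewrite /= /corestr_coact -comp_assoc rcomod_mapP.
by rewrite !comp_assoc tensm_swap.
Qed.

Definition corestr_hom (V W : RComod C) (f : RComodHom V W) :
    RComodHom (corestr_ob V) (corestr_ob W) :=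
  @Build_RComodHom K D (corestr_ob V) (corestr_ob W) f (corestr_homP f).

Lemma corestr_hom_id (V : RComod C) :
  corestr_hom (rcomod_id V) = rcomod_id (corestr_ob V).
Proof. exact: rcomod_hom_eq. Qed.

Lemma corestr_hom_comp (U V W : RComod C) (g : RComodHom V W)
    (f : RComodHom U V) :
  corestr_hom (rcomod_comp g f) = rcomod_comp (corestr_hom g) (corestr_hom f).
Proof. exact: rcomod_hom_eq. Qed.

Definition corestriction : Functor (RComodCat C) (RComodCat D) := {|
  fob := corestr_ob : RComodCat C -> RComodCat D;
  fmap := corestr_hom : forall V W : RComodCat C,
    Hom V W -> Hom (corestr_ob V : RComodCat D) (corestr_ob W);
  fmap_id := corestr_hom_id;
  fmap_comp := corestr_hom_comp
|}.

End Corestriction.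

(** * The adjunction between corestriction and coinduction, and the section built from [chi] *)

Section Adjunction.
Context (K : MonoidalCategory) (eqz : Equalizers K) (flatK : forall X : K, flat X).
Context (C D : Coalgebra K) (psi : CoalgHom C D).

Local Notation e := (coind_arr eqz psi).
Local Notation R := (coinduction eqz flatK psi).
Local Notation L := (corestriction psi).

Lemma coind_arrP_tens (M : RComod D) (X Y : K)
    (h k : Hom Y (coind_ob eqz psi M ⊗ X)) :
  (e M ⊠ idm X) ∘ h = (e M ⊠ idm X) ∘ k -> h = k.
Proof. exact: (equalizer_mono (proj2 (flatK X (coind_arrP eqz psi M)))). Qed.

Definition coind_counit_map (M : RComod D) : Hom (coind_ob eqz psi M) M :=
  run M ∘ (idm M ⊠ counit C) ∘ e M.

(** The coaction duplicates the factor [C], and the counit erases the left copy. This gives both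
    colinearity of the counit map and the triangle identity. *)
Lemma coind_counit_coact (M : RComod D) :
  (coind_counit_map M ⊠ idm C) ∘ coind_coact eqz flatK psi M = e M.
Proof.
rewrite /coind_counit_map !tensm_compl -triangle -!comp_assoc.
rewrite (precomp2 _ (asc_nat _ _ _)) (comp_assoc (asc _ _ _)) coind_coactE.
rewrite !comp_assoc -!tensm_compr comul_counitl.
by rewrite tensm_id comp_id_l.
Qed.

(** Both sides equal [(idm M ⊠ psi) ∘ e M]: on the left, the equalizer equation trades the coaction
    of [M] for that of [C], whose second leg is then erased by the counit. *)
Lemma coind_counitP (M : RComod D) :
  rcoact M ∘ coind_counit_map M =
  (coind_counit_map M ⊠ idm D) ∘ rcoact (corestr_ob psi (coind_comod eqz flatK psi M)).
Proof.
rewrite /= /corestr_coact /= (precomp2 _ (tensm_swap _ _)) coind_counit_coact.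
rewrite /coind_counit_map -!comp_assoc (precomp2 _ (eq_sym (run_nat _))).
rewrite (precomp2 _ (tensm_swap _ _)) -run_tens -(tensm_id M D) -!comp_assoc.
rewrite (precomp2 _ (asc_nat _ _ _)) (comp_assoc (asc _ _ _)) coind_arrE.
rewrite !comp_assoc -!tensm_compr; congr ((_ ⊠ _) ∘ _) => /=.
rewrite -!comp_assoc (precomp2 _ (eq_sym (tensm_swap _ _))).
rewrite (precomp2 _ (run_nat _)).
by rewrite (comp_assoc (run C)) comul_counitr comp_id_r.
Qed.

Definition coind_counit (M : RComodCat D) : Hom (L (R M)) M :=
  @Build_RComodHom K D (corestr_ob psi (coind_comod eqz flatK psi M)) M
    (coind_counit_map M) (coind_counitP M).

Lemma coind_counit_nat (M N : RComodCat D) (u : Hom M N) :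
  coind_counit N ∘ fmap L (fmap R u) = u ∘ coind_counit M.
Proof.
apply: rcomod_hom_eq; rewrite /= /coind_counit_map -!comp_assoc coind_mapE.
by rewrite (precomp2 _ (eq_sym (tensm_swap _ _))) (precomp2 _ (run_nat _)).
Qed.

(** Coassociativity of [V], with [psi] applied to the middle factor. *)
Lemma coind_unit_pre (V : RComod C) :
  asc V D C ∘ (rcoact (corestr_ob psi V) ⊠ idm C) ∘ rcoact V =
  (idm V ⊠ lcoact (lcomod_of_bicomod (coalg_bicomod psi))) ∘ rcoact V.
Proof.
rewrite /= /corestr_coact tensm_compl -!comp_assoc (precomp2 _ (asc_nat _ _ _)).
rewrite tensm_compr -!comp_assoc; congr (_ ∘ _).
by case: (rcoactP V) => <- _; rewrite comp_assoc.
Qed.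

Definition coind_unit_map (V : RComod C) : Hom V (coind_ob eqz psi (corestr_ob psi V)) :=
  eq_lift (coind_arrP eqz psi (corestr_ob psi V)) (coind_unit_pre V).

Lemma coind_unit_mapE (V : RComod C) :
  e (corestr_ob psi V) ∘ coind_unit_map V = rcoact V.
Proof. exact: eq_lift_comp. Qed.

Lemma coind_unitP (V : RComod C) :
  coind_coact eqz flatK psi (corestr_ob psi V) ∘ coind_unit_map V =
  (coind_unit_map V ⊠ idm C) ∘ rcoact V.
Proof.
apply: coind_arrP_tens; apply: asc_inj.
rewrite !comp_assoc coind_coactE -!comp_assoc coind_unit_mapE.
rewrite (precomp _ (eq_sym (tensm_compl _ _ _))) coind_unit_mapE.
by case: (rcoactP V) => <- _; rewrite comp_assoc.
Qed.

Definition coind_unit (V : RComodCat C) : Hom V (R (L V)) :=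
  @Build_RComodHom K C V (coind_comod eqz flatK psi (corestr_ob psi V))
    (coind_unit_map V) (coind_unitP V).

Lemma coind_unit_nat (V W : RComodCat C) (g : Hom V W) :
  coind_unit W ∘ g = fmap R (fmap L g) ∘ coind_unit V.
Proof.
apply: rcomod_hom_eq; apply: (equalizer_mono (coind_arrP eqz psi _)).
rewrite /= (precomp _ (coind_unit_mapE W)) (precomp _ (coind_mapE _ _ _)).
by rewrite -comp_assoc coind_unit_mapE rcomod_mapP.
Qed.

Lemma coind_triangle (M : RComodCat D) :
  fmap R (coind_counit M) ∘ coind_unit (R M) = idm (R M).
Proof.
apply: rcomod_hom_eq; apply: (equalizer_mono (coind_arrP eqz psi _)).
have /= unitE := coind_unit_mapE (coind_comod eqz flatK psi M).
rewrite /= (precomp _ (coind_mapE _ _ _)) -comp_assoc unitE.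
by rewrite coind_counit_coact comp_id_r.
Qed.

Section SectionOfBicomodHom.
Context (chi : BicomodHom (regular_bicomod D) (coalg_bicomod psi)).

(** Coassociativity of [M] reduces this to left colinearity of [chi]. *)
Lemma coind_section_pre (M : RComod D) :
  asc M D C ∘ (rcoact M ⊠ idm C) ∘ ((idm M ⊠ chi) ∘ rcoact M) =
  (idm M ⊠ lcoact (lcomod_of_bicomod (coalg_bicomod psi))) ∘
    ((idm M ⊠ chi) ∘ rcoact M).
Proof.
rewrite -!comp_assoc (precomp2 _ (tensm_swap _ _)) -(tensm_id M D).
rewrite (precomp2 _ (asc_nat _ _ _)) (comp_assoc (asc _ _ _)).
case: (rcoactP M) => -> _; rewrite !comp_assoc -!tensm_compr.
by have /= <- := bicomod_map_l chi.
Qed.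

Definition coind_section_map (M : RComod D) : Hom M (coind_ob eqz psi M) :=
  eq_lift (coind_arrP eqz psi M) (coind_section_pre M).

Lemma coind_section_mapE (M : RComod D) :
  e M ∘ coind_section_map M = (idm M ⊠ chi) ∘ rcoact M.
Proof. exact: eq_lift_comp. Qed.

(** The counterpart with right colinearity of [chi], tested after the monomorphism [e M ⊠ idm D]. *)
Lemma coind_sectionP (M : RComod D) :
  rcoact (corestr_ob psi (coind_comod eqz flatK psi M)) ∘ coind_section_map M =
  (coind_section_map M ⊠ idm D) ∘ rcoact M.
Proof.
apply: coind_arrP_tens; apply: asc_inj.
rewrite /= /corestr_coact /= -!comp_assoc (precomp2 _ (tensm_swap _ _)).
rewrite -(tensm_id M C) (precomp2 _ (asc_nat _ _ _)).
rewrite (comp_assoc (e M ⊠ _)) (comp_assoc (asc _ _ _)) (comp_assoc (asc _ _ _)).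
rewrite coind_coactE -comp_assoc coind_section_mapE.
rewrite (precomp _ (eq_sym (tensm_compl _ _ _))) coind_section_mapE.
rewrite tensm_compl -!comp_assoc (precomp2 _ (asc_nat _ _ _)).
rewrite (comp_assoc (asc _ _ _)).
case: (rcoactP M) => -> _; rewrite !comp_assoc -!tensm_compr.
by have /= -> := bicomod_map_r chi.
Qed.

Definition coind_section (M : RComodCat D) : Hom M (L (R M)) :=
  @Build_RComodHom K D M (corestr_ob psi (coind_comod eqz flatK psi M))
    (coind_section_map M) (coind_sectionP M).

Lemma coind_section_natural :
  counit C ∘ chi = counit D -> natural_section coind_counit coind_section.
Proof.
move=> chi_counit; split.
- move=> M N u; apply: rcomod_hom_eq.
  apply: (equalizer_mono (coind_arrP eqz psi _)).
  rewrite /= (precomp _ (coind_section_mapE N)) (precomp _ (coind_mapE _ _ _)).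
  rewrite -!comp_assoc coind_section_mapE rcomod_mapP.
  by rewrite !comp_assoc tensm_swap.
- move=> M; apply: rcomod_hom_eq; rewrite /= /coind_counit_map -!comp_assoc.
  rewrite coind_section_mapE (precomp _ (eq_sym (tensm_compr _ _ _))) chi_counit.
  by case: (rcoactP M) => _; rewrite comp_assoc.
Qed.

End SectionOfBicomodHom.

Lemma counit_section_separable : bicomod_counit_section psi -> separable R.
Proof.
case=> chi /coind_section_natural.
exact: (natural_section_separable coind_counit_nat).
Qed.

End Adjunction.

(** * Comodules [X ⊗ D] and their colinear maps from and to [D] *)

Section FreeComodule.
Context (K : MonoidalCategory) (D : Coalgebra K).

Definition free_coact (X : K) : Hom (X ⊗ D) (X ⊗ D ⊗ D) :=
  asc_inv X D D ∘ (idm X ⊠ comul D).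

Lemma asc_free_coact (X : K) : asc X D D ∘ free_coact X = idm X ⊠ comul D.
Proof. by rewrite /free_coact comp_assoc asc_invK comp_id_l. Qed.

Lemma free_coactP (X : K) : right_coaction (free_coact X).
Proof.
split.
- apply: asc_inj.
  rewrite -(tensm_id X D) (precomp2 _ (asc_nat _ _ _)) asc_free_coact.
  rewrite -tensm_compr -comul_coassoc -!comp_assoc.
  rewrite (precomp _ (pentagon _ _ _ _)) -!comp_assoc.
  rewrite (precomp _ (eq_sym (tensm_compl _ _ _))) asc_free_coact.
  rewrite (precomp2 _ (asc_nat _ _ _)) asc_free_coact.
  by rewrite -!tensm_compr.
- rewrite -run_tens -(tensm_id X D) -!comp_assoc.
  rewrite (precomp2 _ (asc_nat _ _ _)) asc_free_coact.
  by rewrite -!tensm_compr comp_assoc comul_counitr.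
Qed.

Definition free_comod (X : K) : RComod D :=
  {| rcomod_ob := X ⊗ D; rcoactP := free_coactP X |}.

Definition regular_comod : RComod D :=
  {| rcomod_ob := D; rcoactP := bi_rcoactP (regular_bicomod D) |}.

Lemma comul_homP :
  rcoact (free_comod D) ∘ comul D = (comul D ⊠ idm D) ∘ rcoact regular_comod.
Proof.
apply: asc_inj; rewrite /= (precomp _ (asc_free_coact D)) comp_assoc.
by rewrite comul_coassoc.
Qed.

Definition comul_hom : RComodHom regular_comod (free_comod D) :=
  @Build_RComodHom K D regular_comod (free_comod D) (comul D) comul_homP.

(** The coaction touches only the right factor, so it commutes with contracting [X] by [xi]. These
    maps are the test maps for the cogenerator hypothesis. *)
Lemma free_evalP (X : K) (xi : Hom X unit_ob) :
  rcoact regular_comod ∘ (lun D ∘ (xi ⊠ idm D)) =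
  ((lun D ∘ (xi ⊠ idm D)) ⊠ idm D) ∘ rcoact (free_comod X).
Proof.
rewrite /= tensm_compl -lun_tens -!comp_assoc (precomp2 _ (asc_nat _ _ _)).
rewrite asc_free_coact tensm_id (precomp2 _ (eq_sym (lun_nat _))).
by rewrite tensm_swap.
Qed.

Definition free_eval (X : K) (xi : Hom X unit_ob) :
    RComodHom (free_comod X) regular_comod :=
  @Build_RComodHom K D (free_comod X) regular_comod _ (free_evalP xi).

End FreeComodule.

(** * Recovering a bicomodule map from a natural section *)

Section BicomodHomOfSection.
Context (K : MonoidalCategory) (eqz : Equalizers K) (flatK : forall X : K, flat X).
Context (C D : Coalgebra K) (psi : CoalgHom C D).

Local Notation e := (coind_arr eqz psi).
Local Notation R := (coinduction eqz flatK psi).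
Local Notation L := (corestriction psi).
Local Notation rD := (regular_comod D).

(** The isomorphism [D □_D C -> C]. *)
Definition coind_regular : Hom (coind_ob eqz psi rD) C :=
  lun C ∘ (counit D ⊠ idm C) ∘ e rD.

Lemma coind_regular_coact :
  comul C ∘ coind_regular =
  (coind_regular ⊠ idm C) ∘ coind_coact eqz flatK psi rD.
Proof.
rewrite /coind_regular !tensm_compl -lun_tens -!comp_assoc.
rewrite (precomp2 _ (asc_nat _ _ _)) (comp_assoc (asc _ _ _)) coind_coactE.
rewrite (precomp2 _ (eq_sym (lun_nat _))) tensm_id.
by rewrite (precomp2 _ (eq_sym (tensm_swap _ _))).
Qed.

(** The left coaction of [C] inverts [coind_regular] up to [e]: the equalizer equation replaces it
    by [comul D] on the left factor, whose first leg the counit of [D] erases. *)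
Lemma coind_regular_lcoact :
  (psi ⊠ idm C) ∘ comul C ∘ coind_regular = e rD.
Proof.
rewrite /coind_regular -!(comp_assoc (lun C)) (precomp2 _ (eq_sym (lun_nat _))).
rewrite (precomp2 _ (eq_sym (tensm_swap _ _))).
have /= <- := coind_arrE eqz psi rD.
rewrite -!comp_assoc -(tensm_id D C) (precomp2 _ (eq_sym (asc_nat _ _ _))).
rewrite (precomp _ (lun_tens _ _)) (precomp _ (eq_sym (tensm_compl _ _ _))).
rewrite comp_assoc -tensm_compl comul_counitl.
by rewrite tensm_id comp_id_l.
Qed.

Context (s : forall M : RComodCat D, Hom M (L (R M))).
Hypothesis sP : natural_section (coind_counit eqz flatK psi) s.

(** Following the section by [e M] gives maps between plain tensor products, where naturality and
    the cogenerator tests apply directly. *)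
Definition section_arr (M : RComod D) : Hom M (M ⊗ C) :=
  e M ∘ rcomod_map (s M).

Lemma section_arr_nat (M N : RComod D) (u : RComodHom M N) :
  section_arr N ∘ u = (u ⊠ idm C) ∘ section_arr M.
Proof.
have /(f_equal (@rcomod_map _ _ _ _)) /= s_nat := proj1 sP M N u.
by rewrite /section_arr -comp_assoc s_nat (precomp2 _ (coind_mapE _ _ _)).
Qed.

(* The cogenerator hypothesis reduces this to naturality along the comodule
   maps [X ⊗ D -> D] induced by the [xi : X -> 1]. *)
Lemma section_arr_free (X : K) : left_tensor_cogenerator (unit_ob : K) ->
  asc X D C ∘ section_arr (free_comod D X) = idm X ⊠ section_arr rD.
Proof.
move=> cogen; apply: cogen => xi; apply: lun_inj.
move: (section_arr rD) (section_arr (free_comod D X))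
  (section_arr_nat (free_eval D xi)) => fD fX /=.
rewrite tensm_compl -lun_tens -!comp_assoc (precomp2 _ (asc_nat _ _ _)).
rewrite tensm_id => <-.
by rewrite (precomp2 _ (eq_sym (lun_nat _))) tensm_swap.
Qed.

Definition section_chi : Hom D C := coind_regular ∘ rcomod_map (s rD).

(** By [coind_regular_lcoact] the left side is [section_arr rD]. On the right, the formula on
    [D ⊗ D] and naturality along [comul D] produce [comul D ⊠ idm C] after [section_arr rD]; the
    counit of [D] then erases the second copy of [D]. *)
Lemma section_chi_l : left_tensor_cogenerator (unit_ob : K) ->
  (psi ⊠ idm C) ∘ comul C ∘ section_chi = (idm D ⊠ section_chi) ∘ comul D.
Proof.
move=> cogen; rewrite (precomp _ coind_regular_lcoact).
have -> : section_chi = lun C ∘ (counit D ⊠ idm C) ∘ section_arr rD.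
  by rewrite /section_arr comp_assoc.
move: (section_arr_free D cogen) (section_arr_nat (comul_hom D)) => /=.
rewrite -[e rD ∘ _]/(section_arr rD).
move: (section_arr rD) (section_arr (free_comod D D)) => fD fDD freeE natE.
rewrite !tensm_compr -!comp_assoc -freeE -comp_assoc natE.
rewrite (precomp2 _ (eq_sym (asc_nat _ _ _))) (precomp _ (triangle _ _)).
rewrite !comp_assoc -!tensm_compl comul_counitr.
by rewrite tensm_id comp_id_l.
Qed.

(** Combines [C]-colinearity of [coind_regular] with [D]-colinearity of [s rD] into the corestricted
    comodule. *)
Lemma section_chi_r :
  (idm C ⊠ psi) ∘ comul C ∘ section_chi = (section_chi ⊠ idm D) ∘ comul D.
Proof.
have /= sD := rcomod_mapP (s rD).
rewrite /section_chi; move: coind_regular coind_regular_coact => r rE.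
rewrite -!comp_assoc (precomp _ rE).
rewrite -!comp_assoc (precomp2 _ (eq_sym (tensm_swap _ _))).
rewrite tensm_compl -comp_assoc -sD /corestr_coact.
by rewrite -comp_assoc.
Qed.

(** [counit C ∘ coind_regular] and [counit D ∘ coind_counit_map] are both [counit D ⊠ counit C]
    after [e rD], contracted by [lun] and by [run] on the unit; these coincide, and [s rD] splits
    the counit map. *)
Lemma section_chi_counit : counit C ∘ section_chi = counit D.
Proof.
have /(f_equal (@rcomod_map _ _ _ _)) /= epsK := proj2 sP rD.
rewrite -[RHS]comp_id_r -epsK /section_chi /coind_regular /coind_counit_map.
rewrite -!comp_assoc (precomp2 _ (eq_sym (lun_nat _))).
rewrite (precomp2 _ (eq_sym (tensm_swap _ _))) lun_run_unit.
by rewrite (precomp2 _ (eq_sym (run_nat _))).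
Qed.

Lemma section_counit_section :
  left_tensor_cogenerator (unit_ob : K) -> bicomod_counit_section psi.
Proof.
move=> cogen.
exists (@Build_BicomodHom K D (regular_bicomod D) (coalg_bicomod psi)
  section_chi (section_chi_l cogen) section_chi_r).
exact: section_chi_counit.
Qed.

End BicomodHomOfSection.

(** * Equivalence of the two conditions on [chi], and assembly *)

Lemma split_epi_iff_counit_section (K : MonoidalCategory) (C D : Coalgebra K)
    (psi : CoalgHom C D) : bicomod_split_epi psi <-> bicomod_counit_section psi.
Proof.
split=> -[chi chiP]; exists chi.
  by rewrite -(coalg_map_counit psi) -comp_assoc chiP comp_id_r.
have /= chi_l := bicomod_map_l chi.
(* The right counit law expands the identity of [D] on both sides. Left colinearity then moves [chi]
   into the second factor, where [counit C ∘ chi] becomes [counit D]. *)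
rewrite -[LHS]comp_id_l -(comul_counitr D) -!comp_assoc.
rewrite (precomp2 _ (eq_sym (coalg_map_comul psi))).
rewrite (tensm_rl psi psi) -!comp_assoc (comp_assoc (psi ⊠ idm C)) chi_l.
rewrite !comp_assoc -!(comp_assoc (run D)) -!tensm_compr.
by rewrite coalg_map_counit chiP.
Qed.

Theorem proposition4p5 (K : MonoidalCategory) (eqz : Equalizers K)
    (flatK : forall X : K, flat X) (C D : Coalgebra K) (psi : CoalgHom C D) :
  (bicomod_split_epi psi <-> bicomod_counit_section psi) /\
  (bicomod_split_epi psi \/ bicomod_counit_section psi ->
     separable (coinduction eqz flatK psi)) /\
  (left_tensor_cogenerator (unit_ob : K) ->
     (separable (coinduction eqz flatK psi) <-> bicomod_split_epi psi) /\
     (separable (coinduction eqz flatK psi) <-> bicomod_counit_section psi)).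
Proof.
have i_ii := split_epi_iff_counit_section psi.
have ii_iii := counit_section_separable eqz flatK (psi := psi).
split; [exact: i_ii | split].
  by case=> [/i_ii | ]; exact: ii_iii.
move=> cogen.
have iii_ii : separable (coinduction eqz flatK psi) -> bicomod_counit_section psi.
  case/(separable_natural_section (@coind_unit_nat K eqz flatK C D psi)
    (@coind_triangle K eqz flatK C D psi)) => s sP.
  exact: section_counit_section sP cogen.
split; split=> [/iii_ii | ] //; first by move/i_ii.
by move/i_ii; exact: ii_iii.
Qed.
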